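(* Let $n$ be a non-zero integer with $n\neq\pm 1$, let $B=BS(1,n)=\langle a,t\mid tat^{-1}=a^n\rangle$, and let $G$ be any non-proper HNN extension of $B$. Then $\omega(S)\geq 2^{1/24}$ for every finitely generated subgroup $S$ of $G$ that is not isomorphic to $\{e\}$, $\mathbb{Z}$, $\mathbb{Z}\times\mathbb{Z}$ or the Klein bottle group.
   Context: For a finitely generated group $G$ and a finite generating set $A$ of $G$, let $\gamma_A(n)$ be the number of elements of $G$ of word length at most $n$ with respect to $A\cup A^{-1}$, and let $\omega(G,A)=\lim_{n\to\infty}\gamma_A(n)^{1/n}$ (the limit exists since $\gamma_A$ is submultiplicative). The growth constant of $G$ is $\omega(G)=\inf_A \omega(G,A)$, the infimum being over all finite generating sets $A$ of $G$. A non-proper HNN extension of a group $K$ is a semidirect product $K\rtimes_\alpha\mathbb{Z}=\langle K,s\mid sks^{-1}=\alpha(k)\ (k\in K)\rangle$ for an automorphism $\alpha$ of $K$. The Klein bottle group is $\langle a,t\mid tat^{-1}=a^{-1}\rangle$. *)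

(* Defs.v *)
From HB Require Import structures.
From mathcomp Require Import all_boot all_order all_algebra finmap.
From mathcomp Require Import generic_quotient zify.
From mathcomp Require Import all_classical all_reals all_analysis.

Set Implicit Arguments.
Unset Strict Implicit.
Unset Printing Implicit Defensive.

Import Order.TTheory GRing.Theory Num.Theory.

Local Open Scope group_scope.
Local Open Scope classical_set_scope.

Definition group_isomorphic (G H : groupType) : Prop :=
  exists f : {multiplicative G -> H}, bijective f.

Section Growth.
Variable G : groupType.
Implicit Types (A : {fset G}) (w : seq G) (g : G).

Definition word_over A w : bool := all (fun x => (x \in A) || (x^-1 \in A)) w.

Definition word_ball A (m : nat) : set G :=
  [set g | exists w, [/\ word_over A w, (size w <= m)%N & \prod_(x <- w) x = g]].

Definition generating A : Prop :=
  forall g, exists2 w, word_over A w & \prod_(x <- w) x = g.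

Definition finitely_generated : Prop := exists A, generating A.

(* Ensures that [fset_set] below does not take its default value [fset0]. *)
Lemma finite_word_ball A m : finite_set (word_ball A m).
Proof.
pose B := (A `|` [fset x^-1 | x in A])%fset.
have inB x : (x \in A) || (x^-1 \in A) -> x \in B.
  rewrite in_fsetU => /orP[-> //|xA]; apply/orP; right.
  by apply/imfsetP; exists x^-1; rewrite ?invgK.
elim: m => [|m IHm].
  apply: (@sub_finite_set _ _ [set 1]) => [g|]; last exact: finite_set1.
  by case=> w []; case: w => // _ _; rewrite big_nil => <-.
apply: (@sub_finite_set _ _
  (word_ball A m `|` [set x * y | x in [set` B] & y in word_ball A m])).
  move=> g [[|x w] [/= Aw lew <-]].
    by left; exists [::].
  case/andP: Aw => Ax Aw; right.
  exists x; first exact: inB.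
  by exists (\prod_(y <- w) y); [exists w | rewrite big_cons].
rewrite finite_setU; split=> //.
by apply: finite_image2 => //; exact: finite_fset.
Qed.

Definition growth A (m : nat) : nat := #|` fset_set (word_ball A m)|%fset.

Variable R : realType.

Definition growth_rate A : R :=
  limn (fun m : nat => (growth A m)%:R `^ (m%:R^-1))%R.

Definition growth_constant : R := inf [set growth_rate A | A in generating].

End Growth.

Arguments growth_constant : clear implicits.

Section Presentation.
Variable X : choiceType.

(* The letter [(x, false)] stands for [x], and [(x, true)] for [x^-1]. *)
Definition pres_word : Type := seq (X * bool).

HB.instance Definition _ := Choice.on pres_word.

Definition inv_letter (l : X * bool) : X * bool := (l.1, ~~ l.2).

Definition inv_word (u : pres_word) : pres_word := rev (map inv_letter u).

Definition word_exp (x : X) (n : int) : pres_word :=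
  nseq `|n|%N (x, (n < 0)%R).

(* [R u v] is the defining relation [u = v]. *)
Variable R : pres_word -> pres_word -> Prop.

Inductive pres_cong : pres_word -> pres_word -> Prop :=
| pres_refl u : pres_cong u u
| pres_sym u v : pres_cong u v -> pres_cong v u
| pres_trans u v w : pres_cong u v -> pres_cong v w -> pres_cong u w
| pres_cat u u' v v' :
    pres_cong u u' -> pres_cong v v' -> pres_cong (u ++ v) (u' ++ v')
| pres_cancel l : pres_cong [:: l; inv_letter l] [::]
| pres_rel u v : R u v -> pres_cong u v.

Definition pres_congb : rel pres_word := fun u v => `[< pres_cong u v >].

Lemma pres_congb_equiv : equiv_class_of pres_congb.
Proof.
split=> [u|u v|v u w].
- exact/asboolP/pres_refl.
- by apply/asboolP/asboolP; exact: pres_sym.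
- by move=> /asboolP uv /asboolP vw; apply/asboolP; exact: pres_trans vw.
Qed.

Canonical pres_equiv := EquivRelPack pres_congb_equiv.

Definition presented_group : Type := {eq_quot pres_equiv}%qT.

HB.instance Definition _ := Choice.on presented_group.

Definition pres_pi (u : pres_word) : presented_group :=
  \pi_({eq_quot pres_equiv})%qT u.

Definition pres_mul (x y : presented_group) : presented_group :=
  pres_pi (repr x ++ repr y).

Definition pres_inv (x : presented_group) : presented_group :=
  pres_pi (inv_word (repr x)).

Lemma pres_piP u v : pres_pi u = pres_pi v <-> pres_cong u v.
Proof.
split=> [/eqP|uv]; last by apply/eqP; rewrite eqmodE; apply/asboolP.
by rewrite eqmodE => /asboolP.
Qed.

Lemma pres_reprK x : pres_pi (repr x) = x.
Proof. exact: reprK. Qed.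

Lemma pres_repr_pi u : pres_cong (repr (pres_pi u)) u.
Proof. by apply/pres_piP; rewrite pres_reprK. Qed.

Lemma pres_mulE u v : pres_mul (pres_pi u) (pres_pi v) = pres_pi (u ++ v).
Proof. by apply/pres_piP/pres_cat; exact: pres_repr_pi. Qed.

Lemma inv_letterK : involutive inv_letter.
Proof. by case=> x b; rewrite /inv_letter /= negbK. Qed.

Lemma inv_wordK : involutive inv_word.
Proof.
move=> u; rewrite /inv_word map_rev revK -map_comp map_id_in // => l _.
exact: inv_letterK.
Qed.

Lemma cat_inv_word u : pres_cong (u ++ inv_word u) [::].
Proof.
elim: u => [|l u IHu]; first exact: pres_refl.
rewrite /inv_word /= rev_cons -cats1 -/(inv_word u) -cat_cons catA.
apply: pres_trans (pres_cancel l).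
apply: (@pres_cat _ [:: l] _ [:: inv_letter l]); last exact: pres_refl.
by apply: (@pres_cat [:: l] [:: l] _ [::]) => //; exact: pres_refl.
Qed.

Fact pres_mulA : associative pres_mul.
Proof.
move=> x y z; rewrite -[x]pres_reprK -[y]pres_reprK -[z]pres_reprK.
by rewrite !pres_mulE catA.
Qed.

Fact pres_mul1g : left_id (pres_pi [::]) pres_mul.
Proof. by move=> x; rewrite -[x]pres_reprK pres_mulE. Qed.

Fact pres_mulg1 : right_id (pres_pi [::]) pres_mul.
Proof. by move=> x; rewrite -[x]pres_reprK pres_mulE cats0. Qed.

Fact pres_mulVg : left_inverse (pres_pi [::]) pres_inv pres_mul.
Proof.
move=> x; rewrite -{2}[x]pres_reprK pres_mulE; apply/pres_piP.
by have := cat_inv_word (inv_word (repr x)); rewrite inv_wordK.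
Qed.

Fact pres_mulgV : right_inverse (pres_pi [::]) pres_inv pres_mul.
Proof.
move=> x; rewrite -{1}[x]pres_reprK pres_mulE; apply/pres_piP.
exact: cat_inv_word.
Qed.

HB.instance Definition _ :=
  isGroup.Build presented_group
    pres_mulA pres_mul1g pres_mulg1 pres_mulVg pres_mulgV.

End Presentation.

(* The booleans serve as the two generators. *)
Local Notation gen_a := false (only parsing).
Local Notation gen_t := true (only parsing).

Definition BS_rel (n : int) : pres_word bool -> pres_word bool -> Prop :=
  fun u v =>
    u = word_exp gen_t 1 ++ word_exp gen_a 1 ++ word_exp gen_t (-1) /\
    v = word_exp gen_a n.

Definition BS (n : int) : groupType := presented_group (BS_rel n).

Definition klein_bottle_rel : pres_word bool -> pres_word bool -> Prop :=
  fun u v =>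
    u = word_exp gen_t 1 ++ word_exp gen_a 1 ++ word_exp gen_t (-1) /\
    v = word_exp gen_a (-1).

Definition klein_bottle_group : groupType := presented_group klein_bottle_rel.

(* ['I_1] carries the additive group structure of Z/1. *)
Definition trivial_group : groupType := 'I_1.

Definition infinite_cyclic_group : groupType := Algebra.to_multiplicative int.

Definition free_abelian_group2 : groupType :=
  (infinite_cyclic_group * infinite_cyclic_group)%type.

Record automorphism (K : groupType) := Automorphism {
  aut_fun :> {multiplicative K -> K};
  aut_inv : K -> K;
  aut_funK : cancel aut_fun aut_inv;
  aut_invK : cancel aut_inv aut_fun
}.

(* The pair [(k, i)] stands for [k * s^i]; [alpha] only enters the product. *)
Definition semidirectZ (K : groupType) (alpha : automorphism K) : Type :=
  (K * int)%type.

Section SemidirectZ.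
Variables (K : groupType) (alpha : automorphism K).

Definition aut_exp (i : int) (k : K) : K :=
  match i with
  | Posz m => iter m alpha k
  | Negz m => iter m.+1 (aut_inv alpha) k
  end.

HB.instance Definition _ := Choice.on (semidirectZ alpha).

Definition sdZ_mul (x y : semidirectZ alpha) : semidirectZ alpha :=
  (x.1 * aut_exp x.2 y.1, (x.2 + y.2)%R).

Definition sdZ_one : semidirectZ alpha := (1, 0%R).

Definition sdZ_inv (x : semidirectZ alpha) : semidirectZ alpha :=
  (aut_exp (- x.2)%R x.1^-1, (- x.2)%R).

Lemma aut_expS i k : aut_exp (i + 1)%R k = alpha (aut_exp i k).
Proof.
case: i => [m|[|m]].
- by rewrite [(_ + _)%R](_ : _ = Posz m.+1) //; lia.
- by rewrite /= aut_invK.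
have -> : (Negz m.+1 + 1)%R = Negz m by rewrite !NegzE; lia.
by rewrite /= aut_invK.
Qed.

Lemma aut_expB1 i k : aut_exp (i - 1)%R k = aut_inv alpha (aut_exp i k).
Proof. by rewrite -{2}[i](subrK 1%R) aut_expS aut_funK. Qed.

Lemma aut_expD i j k : aut_exp (i + j)%R k = aut_exp i (aut_exp j k).
Proof.
elim: i => [|m IHm|m IHm]; first by rewrite add0r.
  have -> : (m.+1%:Z + j = m%:Z + j + 1)%R by lia.
  by rewrite aut_expS IHm -aut_expS -PoszD addn1.
have -> : (- m.+1%:Z + j = - m%:Z + j - 1)%R by lia.
rewrite aut_expB1 IHm -aut_expB1.
by have -> : (- m%:Z - 1 = - m.+1%:Z)%R by lia.
Qed.

Lemma aut_expM i : {morph aut_exp i : k l / k * l}.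
Proof.
move=> k l; elim: i => [//|m IHm|m IHm].
  have -> : (m.+1%:Z = m%:Z + 1)%R by lia.
  by rewrite !aut_expS IHm gmulfM.
have -> : (- m.+1%:Z = - m%:Z - 1)%R by lia.
rewrite !aut_expB1 IHm.
by apply: (can_inj (aut_funK alpha)); rewrite gmulfM !aut_invK.
Qed.

Fact sdZ_mulA : associative sdZ_mul.
Proof.
by move=> x y z; rewrite /sdZ_mul /= aut_expM aut_expD mulgA addrA.
Qed.

Fact sdZ_mul1g : left_id sdZ_one sdZ_mul.
Proof. by case=> k i; rewrite /sdZ_mul /= mul1g add0r. Qed.

Lemma aut_exp1 i : aut_exp i 1 = 1.
Proof. by apply: (@mulgI _ (aut_exp i 1)); rewrite -aut_expM !mulg1. Qed.

Fact sdZ_mulg1 : right_id sdZ_one sdZ_mul.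
Proof. by case=> k i; rewrite /sdZ_mul /= aut_exp1 mulg1 addr0. Qed.

Fact sdZ_mulVg : left_inverse sdZ_one sdZ_inv sdZ_mul.
Proof.
by case=> k i; rewrite /sdZ_mul /= -aut_expM mulVg aut_exp1 addNr.
Qed.

Fact sdZ_mulgV : right_inverse sdZ_one sdZ_inv sdZ_mul.
Proof. by case=> k i; rewrite /sdZ_mul /= -aut_expD subrr /= mulgV. Qed.

HB.instance Definition _ :=
  isGroup.Build (semidirectZ alpha)
    sdZ_mulA sdZ_mul1g sdZ_mulg1 sdZ_mulVg sdZ_mulgV.

Lemma semidirectZ_rel (k : K) :
  let s : semidirectZ alpha := (1, 1%R) in
  s * ((k, 0%R) : semidirectZ alpha) * s^-1 = (alpha k, 0%R).
Proof.
move=> s; apply: (@mulIg _ s); rewrite mulgVK.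
by congr pair => /=; rewrite mul1g mulg1.
Qed.

End SemidirectZ.

Definition non_proper_HNN (K G : groupType) : Prop :=
  exists alpha : automorphism K, group_isomorphic G (semidirectZ alpha).

(* Main.v *)
Require Import Defs.
From HB Require Import structures.
From mathcomp Require Import all_boot all_order all_algebra finmap.
From mathcomp Require Import zify ring lra.
From mathcomp Require Import all_classical all_reals all_analysis.

(* An automorphism of [BS(1, n) = Z[1/n] x| Z] scales [Z[1/n]] by some rational
   [u] and fixes the exponent of [t], so [G] is an extension of [Z^2] by a
   subgroup [N] of [Q], on which [g] acts by the scalar
   [lambda g = n^(tau g) u^(sigma g)].
   Given a finite generating set [A] of [S], there are three cases.
   - [lambda = 1] or [-1] on [A]: then [S] is an extension of a cyclic group by
     a cyclic group, because denominators are bounded.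
   - Some [x] in [A] with [lambda x <> 1, -1] is central: then [S] meets [N]
     trivially and embeds in [Z^2].
   - Some [x] and [y] in [A] with [lambda x <> 1, -1] do not commute: then [x]
     and [y x y^-1] have the same linear part, and freely generate a free
     semigroup since a rational number other than 0, 1, -1 is not a root of a
     nonzero polynomial with coefficients in {-1, 0, 1}. This gives
     [2^(m / 3) <= growth A m].
   The first two cases are the excluded groups. *)

Set Implicit Arguments.
Unset Strict Implicit.
Unset Printing Implicit Defensive.

Import Order.TTheory GRing.Theory Num.Theory.
Import numFieldNormedType.Exports.

Local Open Scope ring_scope.

(** * Growth rates *)

Section FeketeLemma.
Local Open Scope classical_set_scope.
Variables (R : realType) (u : nat -> R).
Hypothesis u_ge0 : forall m, 0 <= u m.
Hypothesis uD : forall m k, u (m + k)%N <= u m + u k.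

Lemma subadditive_muln q p : u (q * p)%N <= q%:R * u p + u 0%N.
Proof.
elim: q => [|q IHq]; first by rewrite !mul0n mul0r add0r.
by rewrite mulSn -natr1; apply: le_trans (uD _ _) _; lra.
Qed.

(** The limit is the infimum of [u m / m] over positive [m]: once the quotient at some [p.+1] is
    close to it, Euclidean division by [p.+1] makes all late quotients close. [E] is indexed by
    successors so that no division by zero enters. *)
Lemma subadditive_cvg : cvgn (fun m => u m / m%:R).
Proof.
pose E := [set u m.+1 / m.+1%:R | m in [set: nat]].
have E_lb : lbound E 0 by move=> _ [m _ <-]; rewrite divr_ge0.
have E_inf : has_inf E by split; [exists (u 1%N / 1); exists 0%N | exists 0].
apply/cvg_ex; exists (inf E); apply/cvgrPdist_lt => e e_gt0.
have [_ [p _ <-] up_lt] := inf_adherent (divr_gt0 e_gt0 (ltr0n _ 2)) E_inf.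
(* [C] bounds [u] at every remainder modulo [p.+1], plus the term [u 0] left by
   [subadditive_muln]. *)
pose C := u 0%N + \sum_(r < p.+1) u r.
have C_ge0 : 0 <= C by rewrite addr_ge0 ?sumr_ge0.
near=> m.
have m_gt0 : (0 < m)%N by near: m; exists 1%N.
have Cm : C / m%:R < e / 2.
  rewrite ltr_pdivrMr ?ltr0n// mulrC -ltr_pdivrMr ?divr_gt0//.
  by near: m; exact: nbhs_infty_gtr.
have inf_le : inf E <= u m / m%:R.
  apply: ge_inf; first by exists 0.
  by exists m.-1; rewrite ?prednK.
have um : u m <= m%:R * (u p.+1 / p.+1%:R) + C.
  rewrite {1}(divn_eq m p.+1); apply: le_trans (uD _ _) _.
  have ur : u (m %% p.+1)%N <= \sum_(r < p.+1) u r.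
    pose r0 := Ordinal (ltn_pmod m (ltn0Sn p)).
    by rewrite (bigD1 r0) //= lerDl sumr_ge0.
  rewrite /C addrA lerD//; apply: le_trans (subadditive_muln _ _) _.
  rewrite lerD2r.
  rewrite mulrCA mulrC ler_wpM2l// ler_pdivlMr ?ltr0n//.
  by rewrite -natrM ler_nat leq_trunc_div.
have : u m / m%:R <= u p.+1 / p.+1%:R + C / m%:R.
  rewrite ler_pdivrMr ?ltr0n// mulrDl divfK ?pnatr_eq0 -?lt0n//.
  by rewrite [X in X + _]mulrC.
move: Cm inf_le up_lt; rewrite ltr_distlC.
move: (u m / _) (C / _) (u p.+1 / _) (inf E) => a b c d; lra.
Unshelve. all: by end_near.
Qed.

End FeketeLemma.

Section GrowthRate.
Variables (G : groupType) (A : {fset G}).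

Lemma in_fset_ball m g :
  (g \in fset_set (word_ball A m)) = `[< word_ball A m g >].
Proof. by rewrite in_fset_set //; exact: finite_word_ball. Qed.

(** A word of length at most [m + k] is cut after its first [m] letters. *)
Lemma growthD m k : (growth A (m + k) <= growth A m * growth A k)%N.
Proof.
rewrite /growth -(size_allpairs (fun x y : G => x * y)%g).
apply: uniq_leq_size => [|g]; first exact: fset_uniq.
rewrite in_fset_ball => /asboolP[w [Aw lew <-]].
rewrite -(cat_take_drop m w) big_cat /=.
move: Aw; rewrite -{1}(cat_take_drop m w) /word_over all_cat => /andP[A1 A2].
apply: allpairs_f; rewrite in_fset_ball; apply/asboolP.
  by exists (take m w); split=> //; rewrite size_take_min geq_minl.
by exists (drop m w); split=> //; rewrite size_drop; lia.
Qed.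

Lemma growth_ge_size m (s : seq G) :
  uniq s -> (forall g, g \in s -> word_ball A m g) -> (size s <= growth A m)%N.
Proof.
move=> s_uniq sA; apply: uniq_leq_size => // g /sA Ag.
by rewrite in_fset_ball; apply/asboolP.
Qed.

Lemma growth_gt0 m : (0 < growth A m)%N.
Proof.
apply: (@growth_ge_size m [:: 1%g]) => // g; rewrite inE => /eqP ->.
by exists [::]; rewrite big_nil.
Qed.

(** [limn] is meaningful only for a convergent sequence, so convergence comes first: Fekete's lemma
    applies to the logarithm of the growth, and the exponential is continuous. The bound valid from
    [N] on then passes to the limit. *)
Lemma growth_rate_ge (R : realType) (c : R) (N : nat) :
    0 <= c -> (forall m, (N <= m)%N -> c ^+ m <= (growth A m)%:R) ->
  c <= growth_rate R A.
Proof.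
move=> c_ge0 cA.
have A_gt0 m : 0 < (growth A m)%:R :> R by rewrite ltr0n growth_gt0.
apply: limr_ge; last first.
  near=> m; have m_gt0 : (0 < m)%N by near: m; exists 1%N.
  have lem : (N <= m)%N by near: m; exists N.
  have -> : c = (c ^+ m) `^ m%:R^-1.
    by rewrite -powR_mulrn// -powRrM mulfV ?pnatr_eq0 -?lt0n// powRr1.
  by apply: ge0_ler_powR; rewrite ?invr_ge0 ?nnegrE ?exprn_ge0 ?cA.
pose u m : R := ln (growth A m)%:R.
have -> : (fun m => (growth A m)%:R `^ m%:R^-1) = expR \o (fun m => u m / m%:R).
  by apply/funext => m /=; rewrite /powR gt_eqF// mulrC.
have u_ge0 m : 0 <= u m by rewrite ln_ge0 ?ler1n ?growth_gt0.
have uD m k : u (m + k)%N <= u m + u k.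
  by rewrite -lnM ?posrE// ler_ln ?posrE ?mulr_gt0// -natrM ler_nat growthD.
have /cvg_ex[l ul] := subadditive_cvg u_ge0 uD.
apply/cvg_ex; exists (expR l).
by apply: continuous_cvg; [exact: continuous_expR | exact: ul].
Unshelve. all: by end_near.
Qed.

End GrowthRate.

(** * Free semigroups of affine maps *)

Section Digits.
Variables p r : int.

(* [r ^ (k - 1)] times the value at [p / r] of the polynomial of degree less
   than [k] with coefficients [w], where [k] is the size of [w]. *)
Fixpoint digits_value (w : seq bool) : int :=
  if w is b :: w' then b%:Z * r ^+ size w' + p * digits_value w' else 0.

(** Modulo [p] only the leading digit contributes, multiplied by a power of [r], which is prime to
    [p]. Two leading digits differ by 0, 1 or -1, and [p] divides only the first of these; then [p]
    is cancelled and the tails are compared. *)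
Lemma digits_value_inj (w w' : seq bool) :
    coprimez p r -> (1 < `|p|)%N -> size w = size w' ->
  digits_value w = digits_value w' -> w = w'.
Proof.
move=> pr p_gt1; elim: w w' => [|b w IHw] [|b' w'] //= [sww] eqZ.
have p_neq0 : p != 0 by apply: contraTneq p_gt1 => ->.
have eqb : b = b'.
  have : (p %| (b%:Z - b'%:Z) * r ^+ size w)%Z.
    apply/dvdzP; exists (digits_value w' - digits_value w).
    by move: eqZ; rewrite -sww; lia.
  rewrite Gauss_dvdzl ?coprimezXr// dvdzE /=.
  case: b b' {eqZ} => [] [] //=; rewrite dvdn1 => /eqP p1;
  by rewrite p1 in p_gt1.
congr (_ :: _) => //; apply: IHw => //; apply: (mulfI p_neq0).
by move: eqZ; rewrite -eqb sww => /addrI.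
Qed.

End Digits.

Lemma rat_numq_or_denq_gt1 (m : rat) :
  m != 0 -> m != 1 -> m != -1 -> (1 < `|numq m|)%N || (1 < `|denq m|)%N.
Proof.
move=> m0 m1 mN1; apply: contraT.
rewrite negb_or -!leqNgt => /andP[num_le den_le].
have den1 : denq m = 1 by have := denq_gt0 m; lia.
have num0 : numq m != 0 by rewrite numq_eq0.
have: (numq m = 1) \/ (numq m = -1) by lia.
by case=> num1; move: m1 mN1; rewrite -[m]divq_num_den den1 num1.
Qed.

(** * Affine maps with linear part [lam] and translation part [q] *)

Section FreeSemigroup.
Local Open Scope group_scope.
Variables (S : groupType) (lam q : S -> rat).
Hypothesis lamM : forall g h, lam (g * h) = (lam g * lam h)%R.
Hypothesis lam_neq0 : forall g, lam g != 0%R.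
Hypothesis qM : forall g h, q (g * h) = (q g + lam g * q h)%R.

Lemma cocycle1 : q 1 = 0%R.
Proof.
have := qM 1 1; rewrite mulg1 -{1}[q 1]addr0 => /addrI/esym/eqP.
by rewrite mulf_eq0 (negPf (lam_neq0 _)) => /eqP.
Qed.

Lemma charr1 : lam 1 = 1%R.
Proof. by apply: (mulfI (lam_neq0 1)); rewrite -lamM mulr1 mulg1. Qed.

Lemma charrV g : lam g^-1 = (lam g)^-1%R.
Proof. by apply: (mulfI (lam_neq0 g)); rewrite -lamM mulgV charr1 mulfV. Qed.

Lemma charrJ g h : lam (h * g * h^-1) = lam g.
Proof. by rewrite !lamM charrV mulrAC mulfV ?mul1r. Qed.

Lemma cocycleV g : q g^-1 = (- (lam g)^-1 * q g)%R.
Proof.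
apply: (mulfI (lam_neq0 g)); apply: (addrI (q g)).
by rewrite -qM mulgV cocycle1 mulrA mulrN mulfV// mulN1r subrr.
Qed.

(** As [f] and [g] have the same linear part, replacing [f] by [g] at position [i] changes [q] by
    [(q g - q f) * lam f ^ i]. Comparison with the constant word [f ^+ size w] thus leaves a
    polynomial in [p / r] with coefficients [w]. *)
Lemma cocycle_prod (p r : int) (f g : S) (w : seq bool) :
    lam g = lam f -> (lam f * r%:~R = p%:~R)%R ->
  (r%:~R ^+ size w * (q (\prod_(b <- w) if b then g else f) - q (f ^+ size w)%g)
    = (q g - q f) * r%:~R * (digits_value p r w)%:~R)%R.
Proof.
move=> lamgf lamf; elim: w => [|b w IHw]; first by rewrite big_nil subrr !mulr0.
rewrite big_cons [size _]/= expgS !qM /= rmorphD !rmorphM rmorphXn /= -lamf.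
have -> : lam (if b then g else f) = lam f by case: b.
rewrite !mulrDr.
have -> : ((q g - q f) * r%:~R * (lam f * r%:~R * (digits_value p r w)%:~R)
  = lam f * r%:~R * ((q g - q f) * r%:~R * (digits_value p r w)%:~R))%R by ring.
by rewrite -IHw exprS; case: b => /=; ring.
Qed.

Lemma cocycle_prod_inj (p r : int) (f g : S) (w w' : seq bool) :
    coprimez p r -> (1 < `|p|)%N -> r != 0%R ->
    lam g = lam f -> (lam f * r%:~R = p%:~R)%R -> q g != q f ->
    size w = size w' ->
    \prod_(b <- w) (if b then g else f) =
      \prod_(b <- w') (if b then g else f) ->
  w = w'.
Proof.
move=> pr p_gt1 r0 lamgf lamf qgf sww eqw.
have eq1 := cocycle_prod w lamgf lamf; have eq2 := cocycle_prod w' lamgf lamf.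
apply: (digits_value_inj pr p_gt1 sww); apply: (@intr_inj rat).
have d0 : ((q g - q f) * r%:~R != 0)%R by rewrite mulf_neq0 ?subr_eq0 ?intr_eq0.
by apply: (mulfI d0); rewrite -eq1 -eq2 sww eqw.
Qed.

Section Growth.
Variables (A : {fset S}) (x y : S).
Hypothesis Ax : (x \in A) || (x^-1 \in A).
Hypothesis Ay : (y \in A) || (y^-1 \in A).

(** Words of size [m %/ 3] in [x] and [y * x * y^-1] have distinct values, and each factor costs at
    most three letters of [A]. *)
Lemma growth_ge_free_semigroup (p r : int) m :
    coprimez p r -> (1 < `|p|)%N -> r != 0%R -> (lam x * r%:~R = p%:~R)%R ->
    q (y * x * y^-1) != q x ->
  (2 ^ (m %/ 3) <= growth A m)%N.
Proof.
move=> pr p_gt1 r0 lamx qxy; set k := (m %/ 3)%N.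
pose F (w : k.-tuple bool) := \prod_(b <- w) if b then y * x * y^-1 else x.
have F_inj : injective F.
  move=> w w' eqF; apply/val_inj.
  by apply: cocycle_prod_inj lamx qxy _ eqF; rewrite ?charrJ ?size_tuple.
have -> : (2 ^ k)%N = size (map F (enum {: k.-tuple bool})).
  by rewrite size_map -cardE card_tuple card_bool.
apply: growth_ge_size; first by rewrite map_inj_uniq ?enum_uniq.
move=> _ /mapP[w _ ->].
exists (flatten [seq if b then [:: y; x; y^-1] else [:: x] | b <- w]); split.
- apply/allP => z /flatten_mapP[[] _]; rewrite !inE; last by move=> /eqP ->.
  by case/or3P=> /eqP -> //; rewrite invgK orbC.
- apply: (@leq_trans (k * 3)); last exact: leq_trunc_div.
  rewrite size_flatten /shape -map_comp sumnE big_map.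
  rewrite -[X in (_ <= X * _)%N](size_tuple w).
  rewrite -sum1_size big_distrl /= leq_sum// => b _; by case: b.
rewrite big_flatten big_map /F; apply: eq_bigr => b _.
by case: b; rewrite !big_cons big_nil /= !mulg1 ?mulgA.
Qed.

End Growth.

Lemma growth_ge_noncommuting (A : {fset S}) (x y : S) m :
    (x \in A) || (x^-1 \in A) -> (y \in A) || (y^-1 \in A) ->
    lam x != 1%R -> lam x != (-1)%R -> q (y * x * y^-1) != q x ->
  (2 ^ (m %/ 3) <= growth A m)%N.
Proof.
move=> Ax Ay lx1 lxN1 qxy.
have num_den : (lam x * (denq (lam x))%:~R = (numq (lam x))%:~R)%R.
  by rewrite -[X in (X * _)%R]divq_num_den divfK// intr_eq0.
have cop : coprimez (numq (lam x)) (denq (lam x)) by exact: coprime_num_den.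
case/orP: (rat_numq_or_denq_gt1 (lam_neq0 x) lx1 lxN1) => gt1.
  by apply: growth_ge_free_semigroup num_den qxy.
(* If the denominator exceeds 1, the inverse of [x] is used: its linear part is the inverted
   fraction. *)
apply: (@growth_ge_free_semigroup A x^-1 y _ Ay
  (denq (lam x)) (numq (lam x))) => //.
- by rewrite invgK orbC.
- by rewrite coprimez_sym.
- by rewrite numq_eq0.
- by rewrite charrV -num_den mulKf.
(* Inversion multiplies [q] by a nonzero factor depending only on the linear part, which [x] shares
   with its conjugate, so the two values of [q] stay distinct. *)
have -> : y * x^-1 * y^-1 = (y * x * y^-1)^-1 by rewrite !invgM invgK mulgA.
by rewrite !cocycleV charrJ (inj_eq (mulfI _)) // oppr_eq0 invr_eq0.
Qed.

End FreeSemigroup.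

(** * Presented groups and the normal form in BS(1, n) *)

Local Open Scope group_scope.

Section IntegerPowers.

Definition expgz (G : groupType) (x : G) (i : int) : G :=
  match i with Posz m => x ^+ m | Negz m => x ^- m.+1 end.

Variables (G : groupType).
Implicit Types (x y : G) (i j : int).

Lemma expgz1 x : expgz x 1 = x. Proof. by []. Qed.

Lemma expgzS x i : expgz x (i + 1)%R = expgz x i * x.
Proof.
case: i => [m|[|m]].
- by rewrite [(_ + _)%R](_ : _ = Posz m.+1) ?/expgz ?expgSr //; lia.
- by rewrite /= expg1 mulVg.
have -> : (Negz m.+1 + 1)%R = Negz m by rewrite !NegzE; lia.
by rewrite /expgz [in RHS]expgS invgM mulgVK.
Qed.

Lemma expgzB1 x i : expgz x (i - 1)%R = expgz x i * x^-1.
Proof. by rewrite -{2}[i](subrK 1%R) expgzS mulgK. Qed.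

Lemma expgzD x i j : expgz x (i + j)%R = expgz x i * expgz x j.
Proof.
elim: j => [|m IHm|m IHm]; first by rewrite addr0 mulg1.
  have -> : (m.+1%:Z = m%:Z + 1)%R by lia.
  by rewrite addrA !expgzS IHm mulgA.
have -> : (- m.+1%:Z = - m%:Z - 1)%R by lia.
by rewrite addrA !expgzB1 IHm mulgA.
Qed.

Lemma expgzN x i : expgz x (- i)%R = (expgz x i)^-1.
Proof. by apply: (mulIg (expgz x i)); rewrite -expgzD addNr mulVg. Qed.

Lemma expgzN1 x : expgz x (-1)%R = x^-1.
Proof. by rewrite expgzN. Qed.

Lemma expgzM x i j : expgz x (i * j)%R = expgz (expgz x i) j.
Proof.
elim: j => [|m IHm|m IHm]; first by rewrite mulr0.
  have -> : (m.+1%:Z = m%:Z + 1)%R by lia.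
  by rewrite mulrDr mulr1 !expgzD IHm expgz1.
have -> : (- m.+1%:Z = - m%:Z - 1)%R by lia.
by rewrite mulrDr mulrN1 !expgzD IHm !expgzN expgz1.
Qed.

End IntegerPowers.

Lemma morph_group1 (G H : groupType) (f : G -> H) :
  {morph f : x y / x * y} -> f 1 = 1.
Proof. by move=> fM; apply: (mulgI (f 1)); rewrite -fM !mulg1. Qed.

Lemma morph_groupV (G H : groupType) (f : G -> H) :
  {morph f : x y / x * y} -> {morph f : x / x^-1}.
Proof.
move=> fM x; apply: (mulgI (f x)).
by rewrite -fM !mulgV (morph_group1 fM).
Qed.

Lemma morph_expgz (G H : groupType) (f : G -> H) (x : G) (i : int) :
  {morph f : y z / y * z} -> f (expgz x i) = expgz (f x) i.
Proof.
move=> fM; have f1 := morph_group1 fM; have fV := morph_groupV fM.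
elim: i => [//|m IHm|m IHm].
  have -> : (m.+1%:Z = m%:Z + 1)%R by lia.
  by rewrite !expgzS fM IHm.
have -> : (- m.+1%:Z = - m%:Z - 1)%R by lia.
by rewrite !expgzB1 fM IHm fV.
Qed.

Lemma expgzJ (G : groupType) (x y : G) i :
  expgz (y * x * y^-1) i = y * expgz x i * y^-1.
Proof.
apply/esym; apply: (@morph_expgz G G (fun z => y * z * y^-1)) => u v.
by rewrite !mulgA mulgVK.
Qed.

Section AdditiveMaps.
Variables (G : groupType) (V : zmodType) (f : G -> V).
Hypothesis fM : forall x y, f (x * y) = (f x + f y)%R.
Implicit Types (x y : G) (i : int).

Lemma amap1 : f 1 = 0%R.
Proof. by apply: (addrI (f 1)); rewrite -fM !mulg1 addr0. Qed.

Lemma amapV x : f x^-1 = (- f x)%R.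
Proof. by apply: (addrI (f x)); rewrite -fM mulgV amap1 subrr. Qed.

Lemma amapJ x y : f (y * x * y^-1) = f x.
Proof. by rewrite !fM amapV addrAC subrr add0r. Qed.

Lemma amap_expgz x i : f (expgz x i) = (f x *~ i)%R.
Proof.
elim: i => [|m IHm|m IHm]; first by rewrite amap1.
  have -> : (m.+1%:Z = m%:Z + 1)%R by lia.
  by rewrite expgzS fM IHm mulrzDr.
have -> : (- m.+1%:Z = - m%:Z - 1)%R by lia.
by rewrite expgzB1 fM IHm amapV mulrzDr.
Qed.

End AdditiveMaps.

Section Isomorphisms.
Variables (G H : groupType) (f : G -> H).
Hypothesis fM : {morph f : x y / x * y}.
Hypothesis f_ker : forall x, f x = 1 -> x = 1.
Hypothesis f_surj : forall y, exists x, f x = y.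

(** Both directions are kept: the map to the trivial group starts at the group under study, whereas
    for the other model groups the explicit morphism ends there. *)
Lemma group_isomorphic_of_morph :
  group_isomorphic G H /\ group_isomorphic H G.
Proof.
have f1 := morph_group1 fM; have fV := morph_groupV fM.
have f_inj : injective f.
  move=> x y fxy; apply: (mulIg y^-1); rewrite mulgV; apply: f_ker.
  by rewrite fM fV fxy mulgV.
have [g gK] := boolp.choice f_surj.
have fK : cancel f g by move=> x; apply: f_inj; rewrite gK.
have gM : {morph g : x y / x * y} by move=> x y; apply: f_inj; rewrite fM !gK.
split.
  pose F := isMultiplicative.Build G H f fM.
  by exists (HB.pack_for {multiplicative G -> H} f F); exists g.
pose F := isMultiplicative.Build H G g gM.
by exists (HB.pack_for {multiplicative H -> G} g F); exists f.
Qed.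

End Isomorphisms.

(** * Generators, induction and universal property of a presented group *)

Section PresentedGroup.
Variables (X : choiceType) (R : pres_word X -> pres_word X -> Prop).

Definition pres_gen (x : X) : presented_group R := pres_pi R [:: (x, false)].

Lemma pres_piM u v : pres_pi R (u ++ v) = pres_pi R u * pres_pi R v.
Proof. by rewrite -pres_mulE. Qed.

Lemma pres_pi_letter x b :
  pres_pi R [:: (x, b)] = if b then (pres_gen x)^-1 else pres_gen x.
Proof.
case: b => //; apply: (mulgI (pres_gen x)); rewrite mulgV -pres_piM.
by apply/pres_piP; exact: (pres_cancel R (x, false)).
Qed.

Lemma pres_pi_exp x i : pres_pi R (word_exp x i) = expgz (pres_gen x) i.
Proof.
have nseqE b m : pres_pi R (nseq m (x, b)) =
    (if b then (pres_gen x)^-1 else pres_gen x) ^+ m.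
  elim: m => [//|m IHm]; rewrite -[nseq _ _]/([:: (x, b)] ++ nseq m (x, b)).
  by rewrite pres_piM IHm pres_pi_letter expgS.
by case: i => m; rewrite nseqE //= expVgn.
Qed.

Lemma pres_group_ind (P : presented_group R -> Prop) :
    P 1 -> (forall x g, P g -> P (pres_gen x * g)) ->
    (forall x g, P g -> P ((pres_gen x)^-1 * g)) ->
  forall g, P g.
Proof.
move=> P1 Pgen PgenV g; rewrite -[g]pres_reprK.
elim: (repr g) => [|[x b] u IHu]; first exact: P1.
by rewrite -cat1s pres_piM pres_pi_letter; case: b; auto.
Qed.

Section UniversalProperty.
Variables (H : groupType) (f : X -> H).

Definition word_value (u : pres_word X) : H :=
  \prod_(l <- u) if l.2 then (f l.1)^-1 else f l.1.

Hypothesis f_rel : forall u v, R u v -> word_value u = word_value v.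

Definition pres_lift (g : presented_group R) : H := word_value (repr g).

Lemma word_value_cong u v : pres_cong R u v -> word_value u = word_value v.
Proof.
elim=> {u v} [//|//|u v w _ -> _ -> //|u u' v v' _ Eu _ Ev|[x b]|//].
  by rewrite /word_value !big_cat -/(word_value u) -/(word_value v) Eu Ev.
rewrite /word_value !big_cons !big_nil /= mulg1.
by case: b; rewrite /= ?mulgV ?mulVg.
Qed.

Lemma pres_lift_pi u : pres_lift (pres_pi R u) = word_value u.
Proof. by apply/word_value_cong/pres_repr_pi. Qed.

Lemma pres_liftM : {morph pres_lift : g h / g * h}.
Proof.
move=> g h; rewrite -[g]pres_reprK -[h]pres_reprK -pres_piM !pres_lift_pi.
by rewrite /word_value big_cat.
Qed.

Lemma pres_lift_gen x : pres_lift (pres_gen x) = f x.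
Proof. by rewrite pres_lift_pi /word_value big_cons big_nil /= mulg1. Qed.

Lemma word_value_exp x i : word_value (word_exp x i) = expgz (f x) i.
Proof.
by rewrite -pres_lift_pi pres_pi_exp (morph_expgz _ _ pres_liftM) pres_lift_gen.
Qed.

End UniversalProperty.

End PresentedGroup.

Section BaumslagSolitar.
Variable n : int.

Definition BS_a : BS n := pres_gen (BS_rel n) false.
Definition BS_t : BS n := pres_gen (BS_rel n) true.

Lemma BS_conj_a : BS_t * BS_a * BS_t^-1 = expgz BS_a n.
Proof.
rewrite -pres_pi_exp -[_^-1](pres_pi_letter (BS_rel n) true true).
rewrite -(pres_piM _ [:: (true, false)] [:: (false, false)]).
rewrite -(pres_piM _ _ [:: (true, true)]).
by apply/pres_piP/pres_rel.
Qed.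

Lemma BS_conj_expa i : BS_t * expgz BS_a i * BS_t^-1 = expgz BS_a (n * i)%R.
Proof. by rewrite -expgzJ BS_conj_a expgzM. Qed.

Lemma BS_t_expa i : BS_t * expgz BS_a i = expgz BS_a (n * i)%R * BS_t.
Proof. by rewrite -BS_conj_expa mulgVK. Qed.

Lemma BS_tX_a m : BS_t ^+ m * BS_a = expgz BS_a (n ^+ m)%R * BS_t ^+ m.
Proof.
elim: m => [|m IHm]; first by rewrite mul1g mulg1.
by rewrite expgS -mulgA IHm mulgA BS_t_expa -exprS -mulgA.
Qed.

(** The elements [t^-m a^k t^j] with [m] a natural number contain 1 and are stable under left
    multiplication by generators and their inverses: powers of [a] cross [t^-m] with exponent
    multiplied by [n ^+ m], and [t] either cancels a [t^-1] or, when [m = 0], crosses [a^k]. *)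
Lemma BS_normal_form g : exists i k j,
  g = expgz BS_t i * expgz BS_a k * expgz BS_t j.
Proof.
suff [m [k [j ->]]] : exists (m : nat) (k j : int),
    g = BS_t ^- m * expgz BS_a k * expgz BS_t j.
  by exists (- m%:Z)%R, k, j; rewrite expgzN.
have aV m (k : int) : expgz BS_a k * BS_t ^- m =
    BS_t ^- m * expgz BS_a (n ^+ m * k)%R.
  apply: (mulgI (BS_t ^+ m)); rewrite [RHS]mulgA mulgV mul1g mulgA.
  rewrite -[X in X * _ = _](mulgVK (BS_t ^+ m)) mulgK -expgzJ BS_tX_a mulgK.
  by rewrite expgzM.
elim/pres_group_ind: g => [|[] g [m [k [j ->]]]|[] g [m [k [j ->]]]].
- by exists 0%N, 0%R, 0%R; rewrite !mulg1 invg1.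
- case: m => [|m].
    exists 0%N, (n * k)%R, (1 + j)%R.
    by rewrite !expg0 !invg1 !mul1g expgzD mulgA BS_t_expa mulgA.
  by exists m, k, j; rewrite expgSr invgM !mulgA mulgV mul1g.
- exists m, (n ^+ m + k)%R, j; rewrite expgzD !mulgA; congr (_ * _ * _).
  by have := aV m 1%R; rewrite mulr1.
- by exists m.+1, k, j; rewrite expgSr invgM !mulgA.
- exists m, (- n ^+ m + k)%R, j; rewrite expgzD !mulgA; congr (_ * _ * _).
  by have := aV m (-1)%R; rewrite mulrN1 expgzN1.
Qed.

Lemma BS_rel_value (H : groupType) (a t : H) :
    t * a * t^-1 = expgz a n ->
  forall u v, BS_rel n u v ->
    word_value (fun b : bool => if b then t else a) u =
    word_value (fun b : bool => if b then t else a) v.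
Proof.
move=> ta u v [-> ->]; rewrite (@word_value_exp _ (fun _ _ => False)) //= -ta.
by rewrite /word_value !big_cons big_nil /= mulg1 mulgA.
Qed.

End BaumslagSolitar.

(** * Extensions of cyclic groups by cyclic groups *)

Lemma commute_expgz (G : groupType) (x y : G) i j :
  commute x y -> commute (expgz x i) (expgz y j).
Proof.
have commX (u v : G) k : commute u v -> commute u (expgz v k).
  by move=> uv; rewrite /commute -[LHS](mulgVK u) -expgzJ uv mulgK.
by move=> xy; apply/commX/commute_sym/commX/commute_sym.
Qed.

(** The generator is the least positive element, or 0 if there is none; a nonzero remainder would be
    a smaller positive element. *)
Lemma int_subgroup_generator (I : int -> Prop) :
    I 0%R -> (forall i j, I i -> I j -> I (i - j)%R) ->
  exists d, [/\ (0 <= d)%R, I d & forall i, I i -> (d %| i)%Z].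
Proof.
move=> I0 IB; have IN i : I i -> I (- i)%R.
  by move=> Ii; rewrite -sub0r; exact: IB.
have ID i j : I i -> I j -> I (i + j)%R.
  by move=> Ii Ij; rewrite -[j]opprK; apply/IB/IN.
have IM k d : I d -> I (k * d)%R.
  move=> Id; elim: k => [|m IHm|m IHm]; first by rewrite mul0r.
    by rewrite -addn1 PoszD mulrDl mul1r; exact: ID.
  by rewrite -addn1 PoszD opprD mulrDl mulN1r; exact: IB.
pose P m := (0 < m)%N && `[< I m%:Z >].
have [[m Pm]|noP] := pselect (exists m, P m); last first.
  exists 0%R; split=> // i Ii; rewrite dvd0z; apply: contra_notT noP => i0.
  exists `|i|%N; rewrite /P absz_gt0 i0; apply/asboolP.
  by case: (ger0P i) => [/gez0_abs ->|/ltz0_abs ->] //; exact: IN.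
have exP : exists m, P m by exists m.
case: (ex_minnP exP) => d /andP[d_gt0 /asboolP Id] d_min.
exists d%:Z; split=> // i Ii; apply/dvdz_mod0P.
have d0 : d%:Z != 0%R by lia.
have Ir : I (i %% d%:Z)%Z by apply: IB => //; exact: IM.
apply/eqP; apply: contraT => r0.
have : P `|(i %% d%:Z)%Z|%N.
  by rewrite /P absz_gt0 r0 gez0_abs ?modz_ge0//; exact/asboolP.
move/d_min; have := modz_ge0 i d0; have := @ltz_pmod i d%:Z; lia.
Qed.

(** * Groups with a morphism [sigma] to the integers whose kernel embeds in the integers by [phi] *)

Section CyclicExtensions.
Variables (S : groupType) (sigma phi : S -> int).
Hypothesis sigmaM : forall g h, sigma (g * h) = (sigma g + sigma h)%R.
Hypothesis phiM : forall g h, sigma g = 0%R -> sigma h = 0%R ->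
  phi (g * h) = (phi g + phi h)%R.
Hypothesis phi_ker : forall g, sigma g = 0%R -> phi g = 0%R -> g = 1.

Lemma phi_expgz g i : sigma g = 0%R -> phi (expgz g i) = (i * phi g)%R.
Proof.
move=> g0; have phi1 : phi 1 = 0%R.
  by apply: (addrI (phi 1)); rewrite -phiM ?(amap1 sigmaM)// mulg1 addr0.
have phiV : phi g^-1 = (- phi g)%R.
  apply: (addrI (phi g)).
  by rewrite -phiM ?(amapV sigmaM) ?g0// mulgV phi1 subrr.
have gX k : sigma (expgz g k) = 0%R by rewrite (amap_expgz sigmaM) g0 mul0rz.
elim: i => [|m IHm|m IHm]; first by rewrite phi1 mul0r.
  have -> : (m.+1%:Z = m%:Z + 1)%R by lia.
  by rewrite expgzS phiM ?gX// IHm mulrDl mul1r.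
have -> : (- m.+1%:Z = - m%:Z - 1)%R by lia.
rewrite expgzB1 phiM ?gX ?(amapV sigmaM) ?g0// IHm phiV; lia.
Qed.

Lemma kernel_eq g h :
  sigma g = 0%R -> sigma h = 0%R -> phi g = phi h -> g = h.
Proof.
move=> g0 h0 gh; have hV0 : sigma h^-1 = 0%R by rewrite (amapV sigmaM) h0.
apply: (mulIg h^-1); rewrite mulgV; apply: phi_ker.
  by rewrite sigmaM g0 hV0.
by rewrite phiM// gh -[h^-1]expgzN1 phi_expgz// mulN1r subrr.
Qed.

Lemma group_isomorphic_trivial :
  (forall g : S, g = 1) -> group_isomorphic S trivial_group.
Proof.
move=> S1; have fM : {morph (fun _ : S => 1 : trivial_group) : x y / x * y}.
  by move=> x y; rewrite mulg1.
apply: (group_isomorphic_of_morph fM _ _).1 => [x _|y]; first exact: S1.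
by exists 1; rewrite [y]ord1.
Qed.

Lemma group_isomorphic_cyclic (x : S) :
    (forall i, expgz x i = 1 -> i = 0%R) ->
    (forall g, exists i, expgz x i = g) ->
  group_isomorphic S infinite_cyclic_group.
Proof.
move=> x_free x_gen.
apply: (@group_isomorphic_of_morph infinite_cyclic_group S (expgz x) _ _ _).2.
- by move=> i j; rewrite -expgzD.
- exact: x_free.
- exact: x_gen.
Qed.

(** Let [b] generate the kernel of [sigma] and let [s] lift a generator of its image. If one of
    these two cyclic groups is trivial, [S] is trivial or infinite cyclic; otherwise [s] acts on the
    powers of [b] by an automorphism of the integers, and its sign separates the last two cases. *)
Lemma cyclic_extension_cases :
  [\/ group_isomorphic S trivial_group,
      group_isomorphic S infinite_cyclic_group,
      group_isomorphic S free_abelian_group2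
    | group_isomorphic S klein_bottle_group].
Proof.
have phi1 : phi 1 = 0%R by have := @phi_expgz 1 0 (amap1 sigmaM); rewrite mul0r.
have [|i j|m [m_ge0 [s ss] m_dvd]] :=
  @int_subgroup_generator (fun i => exists g, sigma g = i).
- by exists 1; exact: amap1 sigmaM.
- by move=> [g <-] [h <-]; exists (g * h^-1); rewrite sigmaM (amapV sigmaM).
have [|i j|d [d_ge0 [b b0 bd] d_dvd]] :=
  @int_subgroup_generator (fun i => exists2 g, sigma g = 0%R & phi g = i).
- by exists 1; [exact: amap1 sigmaM | exact: phi1].
- move=> [g g0 <-] [h h0 <-].
  have hV : sigma h^-1 = 0%R by rewrite (amapV sigmaM) h0.
  exists (g * h^-1); first by rewrite sigmaM g0 hV.
  by rewrite phiM// -[h^-1]expgzN1 phi_expgz// mulN1r.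
have bX k : sigma (expgz b k) = 0%R by rewrite (amap_expgz sigmaM) b0 mul0rz.
have kerb g : sigma g = 0%R -> exists k, g = expgz b k.
  move=> g0; have /dvdzP[k gk] : (d %| phi g)%Z by apply: d_dvd; exists g.
  by exists k; apply: kernel_eq => //; rewrite phi_expgz// bd.
have Sbs g : exists k j, g = expgz b k * expgz s j.
  have /dvdzP[j gj] : (m %| sigma g)%Z by apply: m_dvd; exists g.
  have [|k gk] := kerb (g * expgz s (- j)%R).
    by rewrite sigmaM (amap_expgz sigmaM) ss gj -mulrzl; lia.
  by exists k, j; rewrite -gk -mulgA -expgzD addNr mulg1.
have b_free k : d != 0%R -> expgz b k = 1 -> k = 0%R.
  move=> d0 bk; have := phi_expgz k b0; rewrite bk phi1 bd => /esym/eqP.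
  by rewrite mulf_eq0 (negPf d0) orbF => /eqP.
have s_free k : m != 0%R -> sigma (expgz s k) = 0%R -> k = 0%R.
  move=> m0; rewrite (amap_expgz sigmaM) ss -mulrzl => /eqP.
  by rewrite mulf_eq0 (negPf m0) orbF intz => /eqP.
have [d0|d_neq0] := eqVneq d 0%R.
  have b1X k : expgz b k = 1.
    by apply: phi_ker => //; rewrite phi_expgz// bd d0 mulr0.
  have [m0|m_neq0] := eqVneq m 0%R.
    constructor 1; apply: group_isomorphic_trivial => g.
    have [|k ->] := kerb g; last exact: b1X.
    by apply/eqP; rewrite -dvd0z -m0; apply: m_dvd; exists g.
  constructor 2; apply: (@group_isomorphic_cyclic s) => [k sk|g].
    by apply: s_free; rewrite // sk (amap1 sigmaM).
  by have [k [j ->]] := Sbs g; exists j; rewrite b1X mul1g.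
have [m0|m_neq0] := eqVneq m 0%R.
  constructor 2; apply: (@group_isomorphic_cyclic b) => [k|g].
    exact: b_free.
  have [|k ->] := kerb g; last by exists k.
  by apply/eqP; rewrite -dvd0z -m0; apply: m_dvd; exists g.
have bs_free k j : expgz b k * expgz s j = 1 -> k = 0%R /\ j = 0%R.
  move=> bs1; have j0 : j = 0%R.
    by apply: s_free; rewrite // -[RHS](amap1 sigmaM) -bs1 sigmaM bX add0r.
  by split=> //; apply: b_free => //; move: bs1; rewrite j0 mulg1.
have [|e sbs] := kerb (s * b * s^-1); first by rewrite (amapJ sigmaM).
have [|e' sVbs] := kerb (s^-1 * b * s).
  by rewrite -{2}[s]invgK (amapJ sigmaM).
(* Conjugations by [s] and by [s^-1] cancel, so their exponents on [b] have product 1. *)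
have : expgz b (e * e' - 1)%R = 1.
  by rewrite expgzB1 expgzM -sbs expgzJ -sVbs !mulgA mulgV mul1g mulgK mulgV.
move/b_free => /(_ d_neq0)/eqP; rewrite subr_eq0 => /eqP ee'.
have e_cases : (e = 1 \/ e = -1)%R.
  have e0 : e != 0%R by apply: contra_eq_neq ee' => ->; rewrite mul0r.
  have : (`|e| * `|e'|)%N = 1%N by rewrite -abszM ee'.
  by move=> /eqP; rewrite muln_eq1 => /andP[/eqP e1 _]; lia.
case: e_cases => e1; rewrite {}e1 in sbs.
  constructor 3; have sb : commute s b by rewrite /commute -[LHS](mulgVK s) sbs.
  pose f (x : free_abelian_group2) : S := expgz b x.1 * expgz s x.2.
  have fM : {morph f : x y / x * y}.
    move=> [i j] [i' j']; rewrite /f /= !expgzD -!mulgA; congr (_ * _).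
    by rewrite !mulgA; congr (_ * _); exact: commute_expgz.
  apply: (group_isomorphic_of_morph fM _ _).2 => [[i j] /bs_free[/= -> ->]//|g].
  by have [k [j ->]] := Sbs g; exists (k, j).
constructor 4.
(* The Klein bottle group is [BS (-1)] by definition, so the universal property and the normal form
   of [BS] apply. *)
have f_rel := BS_rel_value sbs.
apply: (group_isomorphic_of_morph (pres_liftM f_rel) _ _).2 => g.
  have [i [k [j ->]]] := BS_normal_form g.
  rewrite !(pres_liftM f_rel) !(morph_expgz _ _ (pres_liftM f_rel)).
  rewrite !(pres_lift_gen f_rel) => sbs1.
  (* The relation [s^i b^k s^j = 1] is conjugated by a power of [s]. *)
  have bsij : expgz b k * expgz s (j + i)%R = 1.
    apply: (mulgI (expgz s i)); rewrite mulg1 expgzD !mulgA sbs1 mul1g //.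
  have [-> ji0] := bs_free _ _ bsij.
  by rewrite mulg1 -expgzD addrC ji0.
have [k [j ->]] := Sbs g.
exists (expgz (BS_a (-1)%R) k * expgz (BS_t (-1)%R) j).
rewrite !(pres_liftM f_rel) !(morph_expgz _ _ (pres_liftM f_rel)).
by rewrite !(pres_lift_gen f_rel).
Qed.

End CyclicExtensions.

(** * The affine action of BS(1, n) and of its extensions by Z *)

Section RationalScaling.
Variables (c : rat) (c_neq0 : c != 0%R).

Let ratg : groupType := Algebra.to_multiplicative rat.

Definition scale_rat (x : ratg) : ratg := (c * (x : rat))%R.

Fact scale_ratM : {morph scale_rat : x y / x * y}.
Proof. by move=> x y; rewrite /scale_rat mulrDr. Qed.

HB.instance Definition _ :=
  isMultiplicative.Build ratg ratg scale_rat scale_ratM.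

Fact scale_ratK : cancel scale_rat (fun x : rat => c^-1 * x)%R.
Proof. by move=> x; rewrite /scale_rat mulKf. Qed.

Fact scale_ratVK : cancel (fun x : rat => c^-1 * x)%R scale_rat.
Proof. by move=> x; rewrite /scale_rat mulVKf. Qed.

(** Its semidirect product with the integers is the group of affine maps [z -> c ^ i * z + x] of the
    rationals. *)
Definition scale_aut : automorphism ratg := Automorphism scale_ratK scale_ratVK.

Lemma scale_aut_exp i (x : rat) : aut_exp scale_aut i x = (c ^ i * x)%R.
Proof.
elim: i => [|m IHm|m IHm]; first by rewrite expr0z mul1r.
  have -> : (m.+1%:Z = m%:Z + 1)%R by lia.
  by rewrite aut_expS IHm exprzDr// expr1z -mulrA [LHS]mulrCA.
have -> : (- m.+1%:Z = - m%:Z - 1)%R by lia.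
by rewrite aut_expB1 IHm exprzDr// -mulrA [LHS]mulrCA.
Qed.

End RationalScaling.

Section TauCocycle.
Variables (G : groupType) (c : rat) (tau : G -> int) (q : G -> rat).
Hypothesis qM : forall g h, q (g * h) = (q g + c ^ tau g * q h)%R.
Hypothesis tauM : forall g h, tau (g * h) = (tau g + tau h)%R.

Lemma tau_cocycle1 : q 1 = 0%R.
Proof.
have := qM 1 1.
by rewrite mulg1 (amap1 tauM) expr0z mul1r -[LHS]addr0 => /addrI.
Qed.

Lemma cocycle_kerM g h : tau g = 0%R -> q (g * h) = (q g + q h)%R.
Proof. by rewrite qM => ->; rewrite mul1r. Qed.

Lemma cocycle_kerV g : tau g = 0%R -> q g^-1 = (- q g)%R.
Proof.
move=> g0; apply: (addrI (q g)).
by rewrite -cocycle_kerM// mulgV tau_cocycle1 subrr.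
Qed.

Lemma cocycle_kerX g i : tau g = 0%R -> q (expgz g i) = (i%:~R * q g)%R.
Proof.
move=> g0; elim: i => [|m IHm|m IHm]; first by rewrite tau_cocycle1 mul0r.
  have -> : (m.+1%:Z = m%:Z + 1)%R by lia.
  by rewrite addrC expgzD cocycle_kerM// IHm rmorphD mulrDl mul1r.
have -> : (- m.+1%:Z = -1 - m%:Z)%R by lia.
rewrite expgzD expgzN1 cocycle_kerM ?(amapV tauM) ?g0// IHm cocycle_kerV//.
by rewrite rmorphD mulrDl mulN1r.
Qed.

Lemma cocycle_kerJ g h : tau h = 0%R -> q (g * h * g^-1) = (c ^ tau g * q h)%R.
Proof.
move=> h0; rewrite -mulgA 2!qM h0 mul1r; apply/eqP.
have := qM g g^-1; rewrite mulgV tau_cocycle1 mulrDr => e.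
by rewrite addrCA -e addr0.
Qed.

Lemma cocycle_zeroX x i : q x = 0%R -> q (expgz x i) = 0%R.
Proof.
move=> x0; elim: i => [|m IHm|m IHm]; first exact: tau_cocycle1.
  have -> : (m.+1%:Z = m%:Z + 1)%R by lia.
  by rewrite expgzS qM IHm x0 mulr0 addr0.
have := qM (expgz x (- m.+1%:Z)) x.
rewrite -expgzS.
have -> : (- m.+1%:Z + 1 = - m%:Z)%R by lia.
by rewrite IHm x0 mulr0 addr0.
Qed.

End TauCocycle.

Section BSAffine.
Variables (n : int) (n_neq0 : n != 0%R).

Let c : rat := n%:~R%R.

Fact ratn_neq0 : c != 0%R. Proof. by rewrite intr_eq0. Qed.

Let M : groupType := semidirectZ (scale_aut ratn_neq0).

(** The translation by 1 and the multiplication by [n], images of [a] and [t]. *)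
Let Ma : M := (1%R : rat, 0%R).
Let Mt : M := (0%R : rat, 1%R).

Let M1 (x : M) : rat := x.1.
Let M2 (x : M) : int := x.2.

Fact M1M x y : M1 (x * y) = (M1 x + c ^ M2 x * M1 y)%R.
Proof. by rewrite -(scale_aut_exp ratn_neq0). Qed.

Fact M2M x y : M2 (x * y) = (M2 x + M2 y)%R.
Proof. by []. Qed.

Lemma BS_affine_rel : Mt * Ma * Mt^-1 = expgz Ma n.
Proof.
apply: (mulIg Mt); rewrite mulgVK.
have eqM (x y : M) : M1 x = M1 y -> M2 x = M2 y -> x = y.
  by case: x y => [x i] [y j] /= -> ->.
have MaX : M2 (expgz Ma n) = 0%R by rewrite (amap_expgz M2M) mul0rz.
apply: eqM; last by rewrite !M2M MaX add0r addr0.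
rewrite !M1M MaX (cocycle_kerX M1M M2M)//.
rewrite [M1 Ma]/(1%R : rat) [M1 Mt]/(0%R : rat).
by rewrite add0r mulr0 addr0 [M2 Mt]/(1%R : int) expr1z.
Qed.

Definition BS_affine : BS n -> M :=
  pres_lift (fun b : bool => if b then Mt else Ma).

Definition BS_tau (g : BS n) : int := (BS_affine g).2.
Definition BS_q (g : BS n) : rat := (BS_affine g).1.

Lemma BS_affineM : {morph BS_affine : g h / g * h}.
Proof. exact: pres_liftM (BS_rel_value BS_affine_rel). Qed.

Lemma BS_tauM g h : BS_tau (g * h) = (BS_tau g + BS_tau h)%R.
Proof. by rewrite /BS_tau BS_affineM. Qed.

Lemma BS_qM g h : BS_q (g * h) = (BS_q g + c ^ BS_tau g * BS_q h)%R.
Proof. by rewrite /BS_q BS_affineM [LHS]/= scale_aut_exp. Qed.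

Lemma BS_affine_a : BS_affine (BS_a n) = Ma.
Proof. exact: pres_lift_gen (BS_rel_value BS_affine_rel) _. Qed.

Lemma BS_affine_t : BS_affine (BS_t n) = Mt.
Proof. exact: pres_lift_gen (BS_rel_value BS_affine_rel) _. Qed.

Lemma BS_tau_a : BS_tau (BS_a n) = 0%R.
Proof. by rewrite /BS_tau BS_affine_a. Qed.

Lemma BS_tau_t : BS_tau (BS_t n) = 1%R.
Proof. by rewrite /BS_tau BS_affine_t. Qed.

Lemma BS_q_a : BS_q (BS_a n) = 1%R.
Proof. by rewrite /BS_q BS_affine_a. Qed.

Lemma BS_q_t : BS_q (BS_t n) = 0%R.
Proof. by rewrite /BS_q BS_affine_t. Qed.

Lemma BS_q_tX i : BS_q (expgz (BS_t n) i) = 0%R.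
Proof. exact: (cocycle_zeroX BS_qM BS_tauM _ BS_q_t). Qed.

(** Faithfulness of the affine representation: on [t^i a^k t^j], [tau] is [i + j] and [q] is
    [c ^ i * k]. *)
Lemma BS_ker g : BS_tau g = 0%R -> BS_q g = 0%R -> g = 1.
Proof.
have [i [k [j ->]]] := BS_normal_form g.
rewrite !BS_tauM !BS_qM !BS_q_tX !(amap_expgz BS_tauM) BS_tau_a BS_tau_t.
rewrite mul0rz !addr0 mulr0 addr0 add0r.
rewrite (cocycle_kerX BS_qM BS_tauM) ?BS_tau_a// BS_q_a mulr1.
rewrite !intz => ij /eqP.
rewrite mulf_eq0 expfz_eq0 (negPf ratn_neq0) andbF /= intr_eq0.
by move=> /eqP ->; rewrite mulg1 -expgzD ij.
Qed.

End BSAffine.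

(** * Automorphisms of BS(1, n) and the resulting HNN extensions *)

Section BSAutomorphism.
Variables (n : int) (n_neq0 : n != 0%R).
Hypotheses (n_neq1 : n != 1%R) (n_neqN1 : n != (-1)%R).
Variable alpha : automorphism (BS n).

Let c : rat := n%:~R%R.
Let c_neq0 : c != 0%R := ratn_neq0 n_neq0.
Let tau : BS n -> int := BS_tau n_neq0.
Let q : BS n -> rat := BS_q n_neq0.
Let tauM : forall g h, tau (g * h) = (tau g + tau h)%R := BS_tauM n_neq0.
Let qM : forall g h, q (g * h) = (q g + c ^ tau g * q h)%R := BS_qM n_neq0.
Let alphaM : {morph alpha : x y / x * y} := @gmulfM _ _ alpha.
Let alphaV := morph_groupV alphaM.
Let alphaX x i : alpha (expgz x i) = expgz (alpha x) i :=
  morph_expgz x i alphaM.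

Definition BS_aut_scale : rat := q (alpha (BS_a n)).
Let u := BS_aut_scale.

(** Applying [tau] after [alpha] to [t a t^-1 = a^n] gives an integer equal to [n] times itself, and
    [n] is not 1. *)
Lemma BS_tau_aut_a : tau (alpha (BS_a n)) = 0%R.
Proof.
have := congr1 (tau \o alpha) (BS_conj_a n); rewrite /= alphaX.
rewrite !alphaM alphaV (amapJ tauM) (amap_expgz tauM) -mulrzl intz => /esym/eqP.
rewrite -subr_eq0 -{2}[tau _]mul1r -mulrBl mulf_eq0 subr_eq0.
by rewrite (negPf n_neq1) => /eqP.
Qed.

Lemma BS_aut_scale_neq0 : u != 0%R.
Proof.
apply/eqP => u0; have := BS_ker BS_tau_aut_a u0.
move/(congr1 (aut_inv alpha)); rewrite aut_funK => a1.
have := BS_q_a n_neq0; rewrite a1 -/q.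
have -> : aut_inv alpha 1 = 1 by rewrite -{1}(morph_group1 alphaM) aut_funK.
by rewrite (tau_cocycle1 qM tauM) => /eqP; rewrite eq_sym oner_eq0.
Qed.

Lemma expr_ratz_inj i : (c ^ i = c)%R -> i = 1%R.
Proof.
have cX : (`|c ^ i| = `|c| ^ i)%R.
  by case: i => m; rewrite /exprz ?normfV normrX.
move=> /(congr1 Num.norm); rewrite cX => ci.
have c1 : (`|c| != 1)%R by rewrite /c -intr_norm -[1%R]/(1%:~R)%R eqr_int; lia.
by apply: (@ieexprIz _ `|c| _ c1); rewrite ?normr_gt0.
Qed.

(** Applying [q] after [alpha] to the same relation gives [c ^ tau (alpha t) * u = c * u]; [u]
    cancels, and the powers of [c] are distinct. *)
Lemma BS_tau_aut_t : tau (alpha (BS_t n)) = 1%R.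
Proof.
apply: expr_ratz_inj; apply: (mulIf BS_aut_scale_neq0).
rewrite /u /BS_aut_scale -(cocycle_kerJ qM tauM)// ?BS_tau_aut_a//.
rewrite -!alphaV -!alphaM BS_conj_a alphaX.
by rewrite (cocycle_kerX qM tauM) ?BS_tau_aut_a.
Qed.

Lemma BS_tau_aut g : tau (alpha g) = tau g.
Proof.
have [i [k [j ->]]] := BS_normal_form g.
rewrite !alphaM !alphaX !tauM !(amap_expgz tauM).
by rewrite BS_tau_aut_a BS_tau_aut_t /tau BS_tau_a BS_tau_t.
Qed.

(** The kernel of [tau] consists of conjugates of powers of [a] by powers of [t]; such a conjugation
    scales [q] equally before and after [alpha], because [alpha] preserves [tau]. *)
Lemma BS_q_aut g : tau g = 0%R -> q (alpha g) = (u * q g)%R.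
Proof.
have [i [k [j ->]]] := BS_normal_form g.
rewrite !tauM !(amap_expgz tauM) /tau BS_tau_a BS_tau_t -/tau.
rewrite mul0rz addr0 !intz.
move=> /eqP; rewrite addr_eq0 => /eqP ->; rewrite -[expgz _ j]invgK -expgzN.
rewrite !alphaM alphaV !alphaX.
have a0 : tau (BS_a n) = 0%R := BS_tau_a n_neq0.
have aX : tau (expgz (BS_a n) k) = 0%R by rewrite (amap_expgz tauM) a0 mul0rz.
have aaX : tau (expgz (alpha (BS_a n)) k) = 0%R.
  by rewrite (amap_expgz tauM) BS_tau_aut_a mul0rz.
rewrite !(cocycle_kerJ qM tauM)// !(cocycle_kerX qM tauM) ?BS_tau_aut_a//.
rewrite !(amap_expgz tauM) BS_tau_aut_t /tau BS_tau_t /q BS_q_a -/q mulr1.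
by rewrite mulrA mulrC.
Qed.

Lemma BS_tau_aut_exp i g : tau (aut_exp alpha i g) = tau g.
Proof.
elim: i => [//|m IHm|m IHm].
  have -> : (m.+1%:Z = m%:Z + 1)%R by lia.
  by rewrite aut_expS BS_tau_aut.
have -> : (- m.+1%:Z = - m%:Z - 1)%R by lia.
by rewrite aut_expB1 -BS_tau_aut aut_invK.
Qed.

Lemma BS_q_aut_exp i g : tau g = 0%R -> q (aut_exp alpha i g) = (u ^ i * q g)%R.
Proof.
move=> g0; elim: i => [|m IHm|m IHm]; first by rewrite expr0z mul1r.
  have -> : (m.+1%:Z = m%:Z + 1)%R by lia.
  rewrite aut_expS BS_q_aut ?BS_tau_aut_exp// IHm expfzDr ?BS_aut_scale_neq0//.
  by rewrite expr1z; ring.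
have -> : (- m.+1%:Z = - m%:Z - 1)%R by lia.
apply: (mulfI BS_aut_scale_neq0); rewrite -BS_q_aut; last first.
  by rewrite BS_tau_aut_exp.
rewrite aut_expB1 aut_invK IHm expfzDr ?BS_aut_scale_neq0//.
by rewrite exprN1 [X in (u * (X * _))%R]mulrC -mulrA mulVKf ?BS_aut_scale_neq0.
Qed.

Let G : groupType := semidirectZ alpha.
Let t := BS_t n.

Definition HNN_tau (g : G) : int := tau g.1.
Definition HNN_sigma (g : G) : int := g.2.
Definition HNN_lambda (g : G) : rat := (c ^ HNN_tau g * u ^ HNN_sigma g)%R.

(* The first component of the commutator of [g] with [t]; a commutator with a
   fixed element is automatically a cocycle on a metabelian group. *)
Definition HNN_q (g : G) : rat := q (g.1 * aut_exp alpha g.2 t * g.1^-1 * t^-1).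

Lemma HNN_tauM g h : HNN_tau (g * h) = (HNN_tau g + HNN_tau h)%R.
Proof. by rewrite /HNN_tau tauM BS_tau_aut_exp. Qed.

Lemma HNN_sigmaM g h : HNN_sigma (g * h) = (HNN_sigma g + HNN_sigma h)%R.
Proof. by []. Qed.

(** This is [[g h, t] = (g [h, t] g^-1) [g, t]]. The commutators lie in the kernel of [tau], where
    [alpha] scales [q] by [u] and conjugation scales it by a power of [c]. *)
Lemma HNN_qM g h : HNN_q (g * h) = (HNN_q g + HNN_lambda g * HNN_q h)%R.
Proof.
case: g h => [k i] [l j]; rewrite /HNN_q /HNN_lambda /HNN_tau /HNN_sigma /=.
set w := l * aut_exp alpha j t * l^-1 * t^-1.
have w0 : tau w = 0%R.
  by rewrite /w tauM (amapJ tauM) BS_tau_aut_exp (amapV tauM) subrr.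
have expV := morph_groupV (aut_expM alpha i).
have -> : k * aut_exp alpha i l * aut_exp alpha (i + j)%R t *
    (k * aut_exp alpha i l)^-1 * t^-1 =
    (k * aut_exp alpha i w * k^-1) * (k * aut_exp alpha i t * k^-1 * t^-1).
  rewrite /w !aut_expM !expV aut_expD invgM !mulgA mulgVK.
  by rewrite mulgVK.
rewrite (cocycle_kerM qM); last by rewrite (amapJ tauM) BS_tau_aut_exp.
rewrite (cocycle_kerJ qM tauM) ?BS_tau_aut_exp// BS_q_aut_exp//.
by rewrite addrC mulrA.
Qed.

(** When [tau] and [sigma] vanish at [g], the commutator with [t] has [q]-value [(1 - c) * q g.1],
    and [c] is not 1. *)
Lemma HNN_ker g :
  HNN_tau g = 0%R -> HNN_sigma g = 0%R -> HNN_q g = 0%R -> g = 1.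
Proof.
case: g => k i; rewrite /HNN_q /HNN_tau /HNN_sigma /= => k0 ->.
rewrite /= -!mulgA.
rewrite (cocycle_kerM qM)// [t * _]mulgA (cocycle_kerJ qM tauM); last first.
  by rewrite (amapV tauM) k0.
rewrite (cocycle_kerV qM tauM)// /tau BS_tau_t expr1z => /eqP.
rewrite mulrN -{1}[q k]mul1r -mulrBl mulf_eq0 subr_eq0 eq_sym.
have c1 : c != 1%R by rewrite /c -[1%R]/(1%:~R)%R eqr_int.
by rewrite (negPf c1) => /eqP qk; rewrite (BS_ker k0 qk).
Qed.

End BSAutomorphism.

(** * Affine groups of small growth *)

Section AffineGroups.
Variables (S : groupType) (c u : rat) (tau sigma : S -> int) (q : S -> rat).
Let lam (g : S) : rat := (c ^ tau g * u ^ sigma g)%R.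
Hypotheses (c_neq0 : c != 0%R) (c_norm : (`|c| != 1)%R) (u_neq0 : u != 0%R).
Hypothesis tauM : forall g h, tau (g * h) = (tau g + tau h)%R.
Hypothesis sigmaM : forall g h, sigma (g * h) = (sigma g + sigma h)%R.
Hypothesis qM : forall g h, q (g * h) = (q g + lam g * q h)%R.
Hypothesis q_ker : forall g, tau g = 0%R -> sigma g = 0%R -> q g = 0%R -> g = 1.

Let lamM g h : lam (g * h) = (lam g * lam h)%R.
Proof. by rewrite /lam tauM sigmaM !expfzDr// mulrACA. Qed.

Let lam_neq0 g : lam g != 0%R.
Proof. by rewrite mulf_neq0 ?expfz_neq0. Qed.

Let lam_ker g : tau g = 0%R -> sigma g = 0%R -> lam g = 1%R.
Proof. by rewrite /lam => -> ->; rewrite mulr1. Qed.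

Lemma affine_eq g h : tau g = tau h -> sigma g = sigma h -> q g = q h -> g = h.
Proof.
move=> tgh sgh qgh; apply: (mulIg h^-1); rewrite mulgV; apply: q_ker.
- by rewrite tauM (amapV tauM) tgh subrr.
- by rewrite sigmaM (amapV sigmaM) sgh subrr.
rewrite qM (cocycleV lam_neq0 qM) /lam tgh sgh qgh -/(lam h).
by rewrite mulrA mulrN mulfV// mulN1r subrr.
Qed.

(** If [tau] and [sigma] vanish at [g], commuting with [x] forces [lam x * q g = q g], hence
    [g = 1]. So [tau] is injective on the kernel of [sigma] and can serve as [phi]. *)
Lemma cases_of_central x : lam x != 1%R -> (forall g, commute x g) ->
  [\/ group_isomorphic S trivial_group,
      group_isomorphic S infinite_cyclic_group,
      group_isomorphic S free_abelian_group2
    | group_isomorphic S klein_bottle_group].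
Proof.
move=> lx xC; apply: (@cyclic_extension_cases S sigma tau) => // g sg tg.
apply: q_ker => //; have := congr1 q (xC g); rewrite !qM (lam_ker tg sg) mul1r.
rewrite addrC => /addIr/eqP; rewrite -subr_eq0 -{2}[q g]mul1r -mulrBl mulf_eq0.
by rewrite subr_eq0 (negPf lx) => /eqP.
Qed.

Variable A : {fset S}.
Hypothesis A_gen : generating A.
Let letter x := (x \in A) || (x^-1 \in A).

Lemma generated_ind (P : S -> Prop) :
  P 1 -> (forall x g, letter x -> P g -> P (x * g)) -> forall g, P g.
Proof.
move=> P1 PM g; have [w Aw <-] := A_gen g.
elim: w Aw => [|x w IHw] /= Aw; first by rewrite big_nil.
by case/andP: Aw => Ax Aw; rewrite big_cons; apply: PM => //; exact: IHw.
Qed.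

(* The denominators of [q] are bounded since [lam] takes unit values only. *)
Lemma cases_of_unit_lambda :
    (forall x, letter x -> lam x = 1%R \/ lam x = (-1)%R) ->
  [\/ group_isomorphic S trivial_group,
      group_isomorphic S infinite_cyclic_group,
      group_isomorphic S free_abelian_group2
    | group_isomorphic S klein_bottle_group].
Proof.
move=> lamA; have lam1 g : lam g = 1%R \/ lam g = (-1)%R.
  elim/generated_ind: g => [|x g /lamA lx lg].
    by left; apply: lam_ker; rewrite ?(amap1 tauM) ?(amap1 sigmaM).
  by rewrite lamM; case: lx lg => -> [] ->; rewrite ?mulrNN ?mulr1 ?mul1r; auto.
pose D : rat := (\prod_(a <- A) denq (q a))%:~R%R.
have D_neq0 : D != 0%R.
  rewrite intr_eq0; elim: (enum_fset A) => [|a s IHs]; first by rewrite big_nil.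
  by rewrite big_cons mulf_neq0.
have DA a : a \in A -> (D * q a)%R \is a Num.int.
  move=> Aa; rewrite /D (big_rem a)//= rmorphM /= mulrAC.
  apply: rpredM; last exact: intr_int.
  by rewrite mulrC -[X in (X * _)%R]divq_num_den divfK ?intr_eq0// intr_int.
have lam_int g h :
    (D * q h)%R \is a Num.int -> (D * (lam g * q h))%R \is a Num.int.
  by case: (lam1 g) => ->; rewrite ?mul1r// mulN1r mulrN rpredN.
have DS g : exists z : int, (D * q g = z%:~R)%R.
  suff /intrP[z ->] : (D * q g)%R \is a Num.int by exists z.
  elim/generated_ind: g => [|x g lx Dg].
    by rewrite (cocycle1 lam_neq0 qM) mulr0 rpred0.
  rewrite qM mulrDr rpredD ?lam_int//; case/orP: lx => [/DA//|xVA].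
  have DxV := DA _ xVA.
  rewrite -[x]invgK (cocycleV lam_neq0 qM) mulNr mulrN rpredN.
  by rewrite -(charrV lamM lam_neq0) lam_int.
have [phi phiE] := boolp.choice DS.
(* When [sigma g = 0], [lam g] is a power of [c] of absolute value 1. Hence on the kernel of [sigma]
   also [tau] vanishes and [lam] is 1, so [D * q] is additive and injective there. *)
have tau0 g : sigma g = 0%R -> tau g = 0%R.
  move=> sg; have cX : (`|c| ^ tau g = 1)%R.
    have -> : (`|c| ^ tau g = `|c ^ tau g|)%R.
      by case: (tau g) => m; rewrite /exprz ?normfV normrX.
    have := lam1 g; rewrite /lam sg mulr1.
    by case=> ->; rewrite ?normrN1 ?normr1.
  by apply: (@ieexprIz _ `|c|%R _ c_norm); rewrite ?normr_gt0.
apply: (@cyclic_extension_cases S sigma phi) => // [g h sg sh|g sg pg].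
  apply: (@intr_inj rat); rewrite rmorphD /= -!phiE qM mulrDr.
  by rewrite lam_ker ?tau0// mul1r.
apply: q_ker => //; first exact: tau0.
by apply: (mulfI D_neq0); rewrite phiE pg mulr0.
Qed.

Lemma affine_group_cases :
  [\/ group_isomorphic S trivial_group,
      group_isomorphic S infinite_cyclic_group,
      group_isomorphic S free_abelian_group2
    | group_isomorphic S klein_bottle_group] \/
  forall m, (2 ^ (m %/ 3) <= growth A m)%N.
Proof.
have [[x [Ax lx1 lxN1]]|no_x] :=
  pselect (exists x, [/\ letter x, lam x != 1%R & lam x != (-1)%R]); last first.
  left; apply: cases_of_unit_lambda => x Ax.
  have [|lx1] := eqVneq (lam x) 1%R; first by left.
  by have [|lxN1] := eqVneq (lam x) (-1)%R; [right | case: no_x; exists x].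
have [[y Ay qxy]|no_y] :=
  pselect (exists2 y, letter y & q (y * x * y^-1) != q x).
  by right=> m; exact: (growth_ge_noncommuting lamM lam_neq0 qM m Ax Ay).
left; apply: (cases_of_central lx1) => g; elim/generated_ind: g => [|y g Ay xg].
  exact: commute1.
apply: commuteM xg; rewrite /commute -[RHS](mulgVK y); congr (_ * _).
(* Conjugation preserves [tau] and [sigma], so commuting with [x] is decided by [q] alone. *)
apply/esym/affine_eq; rewrite ?(amapJ tauM) ?(amapJ sigmaM)//.
by apply/eqP; apply: contrapT => /negP qxy; apply: no_y; exists y.
Qed.

End AffineGroups.

Local Open Scope ring_scope.

Theorem corollary4p4 (R : realType) (n : int)
    (n_neq0 : n != 0) (n_neq1 : n != 1) (n_neqN1 : n != -1)
    (G : groupType) (G_HNN : non_proper_HNN (BS n) G)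
    (P : pred G) (S : subGroupType P) (S_fg : finitely_generated S)
    (S_not_trivial : ~ group_isomorphic S trivial_group)
    (S_not_Z : ~ group_isomorphic S infinite_cyclic_group)
    (S_not_Z2 : ~ group_isomorphic S free_abelian_group2)
    (S_not_Klein : ~ group_isomorphic S klein_bottle_group) :
  2 `^ (24^-1) <= growth_constant S R.
Proof.
have [alpha [f f_bij]] := G_HNN; have f_inj := bij_inj f_bij.
pose F (x : S) := f (val x).
have FM : {morph F : x y / (x * y)%g} by move=> x y; rewrite /F valM gmulfM.
have F_ker x : F x = 1%g -> x = 1%g.
  by rewrite -(morph_group1 FM) => /f_inj/val_inj.
have c_norm : `|n%:~R : rat| != 1.
  by rewrite -intr_norm -[1]/(1%:~R) eqr_int; lia.
pose tau x := HNN_tau n_neq0 (F x); pose sigma x := HNN_sigma (F x).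
pose q x := HNN_q n_neq0 (F x).
have tauM x y : tau (x * y)%g = tau x + tau y.
  by rewrite /tau FM HNN_tauM.
have sigmaM x y : sigma (x * y)%g = sigma x + sigma y.
  by rewrite /sigma FM HNN_sigmaM.
have growthS (A : {fset S}) :
    generating A -> forall m, (2 ^ (m %/ 3) <= growth A m)%N.
  move=> A_gen.
  have := @affine_group_cases S n%:~R (BS_aut_scale n_neq0 alpha) tau sigma q
    (ratn_neq0 n_neq0) c_norm (BS_aut_scale_neq0 n_neq0 n_neq1 alpha)
    tauM sigmaM _ _ A A_gen.
  case=> [x y||[]|] //.
    by rewrite /q FM HNN_qM.
  by move=> x tx sx qx; apply/F_ker/(HNN_ker n_neq1 tx sx qx).
(* [inf] takes a default value on the empty set; finite generation provides an element. *)
apply: lb_le_inf => [|_ [A A_gen <-]].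
  by have [A A_gen] := S_fg; exists (growth_rate R A); exists A.
(* The inequality [m <= 24 * (m %/ 3)] fails for [m] equal to 1 or 2 and holds from 3 on. *)
apply: (@growth_rate_ge _ _ _ _ 3); first exact: powR_ge0.
move=> m m_ge3; apply: (@le_trans _ _ (2 ^ (m %/ 3))%:R); last first.
  by rewrite ler_nat growthS.
rewrite -powR_mulrn ?powR_ge0// -powRrM natrX -powR_mulrn// ler_powR ?ler1n//.
rewrite mulrC ler_pdivrMr// -natrM ler_nat; lia.
Qed.
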